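(* Let $1\le p<\infty$ and let $X$ be a Banach space with an $\ell_p$-asymptotic model generated by a weakly null array. Then for every increasing function $f:[0,\infty)\to[0,\infty)$ satisfying $$\int_1^\infty\left(\frac{f(t)}{t}\right)^p\frac{1}{t}\,dt<\infty,$$ there exist maps $F_k:[\mathbb{N}]^{\le k}\to X$, $k\in\mathbb{N}$, from the countably branching trees $([\mathbb{N}]^{\le k},d_T)$ with uniformly bounded (in $k$) Lipschitz constants, and a constant $c>0$ independent of $k$ and $t$, such that for every $k\in\mathbb{N}$, $\rho_{F_k}(t)\ge c\,f(t/8)$ for all $t\ge 3$.
   Context: Countably branching tree of depth $k$: $[\mathbb{N}]^{\le k}=\{A\subset\mathbb{N}:0\le|A|\le k\}$, with elements written as increasing tuples and the root being the empty set, and with metric $d_T$: if $\bar u$ is the longest common initial segment of $\bar m=(\bar u,m_1,\dots,m_a)$ and $\bar n=(\bar u,n_1,\dots,n_b)$, then $d_T(\bar m,\bar n)=a+b$. Compression: for a map $F:(Y,d_Y)\to(Z,d_Z)$ of metric spaces, $\rho_F(t)=\inf_{d_Y(x,y)\ge t}d_Z(F(x),F(y))$ (with $\inf\emptyset=+\infty$). $\ell_p$-asymptotic model: a basic sequence $(e_i)_{i=1}^\infty$ is an $\ell_p$-asymptotic model of a Banach space $X$, generated by the array $(x_j^{(i)}:i,j\in\mathbb{N})\subset S_X$ (the unit sphere of $X$), if there is a null sequence of scalars $(\epsilon_n)_{n=1}^\infty\subset(0,1)$ such that for all $n\in\mathbb{N}$, all $\{a_i\}_{i=1}^n\subset[-1,1]$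 and all $n\le k_1<\dots<k_n$, $$\left|\ \Big\|\sum_{i=1}^n a_i x_{k_i}^{(i)}\Big\|-\Big(\sum_{i=1}^n|a_i|^p\Big)^{1/p}\ \right|<\epsilon_n .$$ The array is weakly null if for each $i$ the row $(x_j^{(i)})_{j=1}^\infty$ is weakly null in $X$. *)

(* Defs.v *)
From mathcomp Require Export all_boot all_order all_algebra.
From mathcomp Require Export all_classical all_reals all_analysis.
From mathcomp Require Import zify.
Set Implicit Arguments.
Unset Strict Implicit.
Unset Printing Implicit Defensive.
Import Order.TTheory GRing.Theory Num.Theory.
Import numFieldNormedType.Exports.
Local Open Scope classical_set_scope.
Local Open Scope ring_scope.

(* Longest common initial segment. *)
Fixpoint lcp (T : eqType) (s t : seq T) : seq T :=
  match s, t with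
  | x :: s', y :: t' => if x == y then x :: lcp s' t' else [::]
  | _, _ => [::]
  end.

Lemma lcpC (T : eqType) : commutative (@lcp T).
Proof.
elim=> [|x s IHs] [|y t] //=; rewrite (eq_sym y).
by case: eqP => [->|//]; rewrite IHs.
Qed.

Lemma prefix_lcpl (T : eqType) (s t : seq T) : prefix (lcp s t) s.
Proof.
elim: s t => [|x s IHs] [|y t] //=; case: eqP => [_|//].
by rewrite eqxx IHs.
Qed.

Lemma prefix_lcpr (T : eqType) (s t : seq T) : prefix (lcp s t) t.
Proof. by rewrite lcpC prefix_lcpl. Qed.

Lemma lcp_max (T : eqType) (u s t : seq T) :
  prefix u s -> prefix u t -> prefix u (lcp s t).
Proof.
elim: u s t => [|z u IHu] [|x s] [|y t] //=; first by rewrite prefix0s.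
have [-> us|//] := eqVneq z x; have [-> ut|//] := eqVneq x y.
by rewrite /= eqxx; exact: IHu.
Qed.

(* The vertices of the countably branching tree of depth k: finite subsets of
   nat with at most k elements, each given by its increasing enumeration. *)
Definition tree (k : nat) : Type :=
  {s : seq nat | sorted ltn s && (size s <= k)%N}.

Definition tree_dist (k : nat) (x y : tree k) : nat :=
  ((size (val x) - size (lcp (val x) (val y))) +
   (size (val y) - size (lcp (val x) (val y))))%N.

Lemma tree_dist_eq0 (k : nat) (x y : tree k) : (tree_dist x y == 0%N) = (x == y).
Proof.
rewrite addn_eq0 !subn_eq0; apply/idP/eqP => [/andP[xl yl]|->]; last first.
  by apply/andP; split; apply: size_prefix; apply: lcp_max; exact: prefix_refl.
have pfx_full (s t : seq nat) : prefix s t -> (size t <= size s)%N -> s = t.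
  by move=> /prefixP[r ->]; rewrite size_cat -{2}[size s]addn0 leq_add2l leqn0
     size_eq0 => /eqP ->; rewrite cats0.
by apply: val_inj; rewrite -(pfx_full _ _ (prefix_lcpr _ _) yl)
   {1}(pfx_full _ _ (prefix_lcpl _ _) xl).
Qed.

Lemma tree_distC (k : nat) (x y : tree k) : tree_dist x y = tree_dist y x.
Proof. by rewrite /tree_dist addnC lcpC. Qed.

Lemma tree_dist_triangle (k : nat) (y x z : tree k) :
  (tree_dist x z <= tree_dist x y + tree_dist y z)%N.
Proof.
rewrite /tree_dist; move: (val x) (val y) (val z) => {}x {}y {}z.
have [xyx xyy] := (prefix_lcpl x y, prefix_lcpr x y).
have [yzy yzz] := (prefix_lcpl y z, prefix_lcpr y z).
have nest (u v : seq nat) :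
    prefix u y -> prefix v y -> (size u <= size v)%N -> prefix u v.
  rewrite !prefixE => /eqP uE /eqP vE uv.
  by rewrite -vE take_takel // uE.
have ultra : (minn (size (lcp x y)) (size (lcp y z)) <= size (lcp x z))%N.
  case: (leqP (size (lcp x y)) (size (lcp y z))) => [le|/ltnW le].
    apply/size_prefix/lcp_max => //.
    exact: prefix_trans (nest _ _ xyy yzy le) yzz.
  apply/size_prefix/lcp_max => //.
  exact: prefix_trans (nest _ _ yzy xyy le) xyx.
have arith (a b c p q r : nat) : (minn a b <= c)%N -> (a <= p)%N ->
    (a <= q)%N -> (b <= q)%N -> (b <= r)%N -> (c <= p)%N -> (c <= r)%N ->
    (p - c + (r - c) <= p - a + (q - a) + (q - b + (r - b)))%N by lia.
apply: arith; [exact: ultra|..]; apply: size_prefix => //.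
  exact: prefix_lcpl.
exact: prefix_lcpr.
Qed.

Definition lipschitz_with (R : realType) (Y Z : Type) (dY : Y -> Y -> R)
    (dZ : Z -> Z -> R) (L : R) (F : Y -> Z) : Prop :=
  forall x y, dZ (F x) (F y) <= L * dY x y.

(* Extended-real valued, so that the infimum of the empty set is +oo. *)
Definition compression (R : realType) (Y Z : Type) (dY : Y -> Y -> R)
    (dZ : Z -> Z -> R) (F : Y -> Z) (t : R) : \bar R :=
  ereal_inf [set (dZ (F xy.1) (F xy.2))%:E | xy in [set xy | t <= dY xy.1 xy.2]].

Definition norm_dist (R : realType) (X : normedModType R) (u v : X) : R :=
  `|u - v|.

Definition weakly_null (R : realType) (X : normedModType R) (u : nat -> X) :
    Prop :=
  forall phi : {linear X -> R^o}, continuous phi -> phi (u j) @[j --> \oo] --> 0.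

Definition weakly_null_array (R : realType) (X : normedModType R)
    (x : nat -> nat -> X) : Prop :=
  forall i, weakly_null (x i).

(* [x i j] is the j-th vector of row i.  Rows are numbered from 0, so that the
   first n rows are indexed by 'I_n.  The generated basic sequence is the
   unit vector basis of l_p, so it is not an argument. *)
Definition generates_lp_asymptotic_model (R : realType) (p : R)
    (X : normedModType R) (x : nat -> nat -> X) : Prop :=
  (forall i j, `|x i j| = 1) /\
  exists eps : nat -> R,
    [/\ forall n, 0 < eps n < 1,
        eps n @[n --> \oo] --> 0 &
        forall (n : nat) (a : 'I_n -> R) (k : 'I_n -> nat),
          (forall i, -1 <= a i <= 1) ->
          (forall i, n <= k i)%N ->
          (forall i j : 'I_n, i < j -> k i < k j)%N ->
          `| `|\sum_(i < n) a i *: x i (k i)|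
             - (\sum_(i < n) `|a i| `^ p) `^ p^-1 | < eps n].

(* Main.v *)
Require Import Defs.
From HB Require Import structures.
From mathcomp Require Import measurable_realfun zify ring lra.
Import Order.TTheory GRing.Theory Num.Theory.
Import numFieldNormedType.Exports.
Set Implicit Arguments.
Unset Strict Implicit.
Unset Printing Implicit Defensive.
Local Open Scope classical_set_scope.
Local Open Scope ring_scope.

(** A vertex [s] of the tree is sent to the sum, over its nonempty initial
    segments [q], of [w (size s - size q)] times the vector of row
    [(size q).-1] and column [node q], where [node] is injective on vertices
    and increases along branches.  The weight is
    [w j = 1 + \sum_(1 <= i <= j) f i / i `^ (1 + 1 / p)].

    Lipschitz bound.  When [s] is replaced by one of its children, each
    coefficient moves from [w j] to [w j.+1] and one new coefficient [w 0 = 1]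
    appears.  All the vectors involved lie on one branch, hence in distinct
    rows and increasing columns, so the asymptotic model computes the norm of
    the difference: up to a small error it is the [l_p] norm of the increments
    of [w], and the [p]-th powers of these increments, [(f i / i) `^ p / i],
    have bounded sums by the integral condition ([increment_summable]).

    Compression bound.  Let [a] be the number of entries of [s] past its common
    part with [t].  As [w] is nondecreasing, at least a quarter of
    [w 0, ..., w a.-1] exceed [f (a / 4) / 4] times the [p]-th root of [1 / a],
    so the [l_p] norm of these [a] weights is at least [f (a / 4) / 16]
    ([weight_sum_ge]).  One of the two vertices has [a] at least half of their
    distance, which explains [f (t / 8)].  It remains to bound the norm of
    the difference of the two images from below by the norm of the part that
    [s] does not share with [t].  The asymptotic model does not apply to the
    whole difference, because the two branches meet the same rows.

    This is where weak nullity enters.  By [finite_suppression_unconditional],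
    a finite family of bounded weakly null sequences has common subsequences
    along which deleting terms from a sum of bounded length increases its norm
    by at most a prescribed amount.  For the proof, consider the limit of
    [`|u_1 j_1 + ... + u_n j_n|] for [j_n], then [j_{n-1}], ..., then [j_1]
    tending to infinity along an ultrafilter.  Each partial limit is a convex
    function of the sum of the terms not yet sent to infinity; a continuous
    convex function dominates a continuous affine function that touches it at
    a given point (Hahn-Banach, [convex_minorant]), so adding a weakly null
    perturbation and passing to the limit cannot decrease it
    ([le_tail_lim]).  Deleting a term therefore does not increase the iterated
    limit, and a diagonal choice of indices makes the actual norms close to
    the iterated limits ([iter_lim_approx]). *)

(** * Affine minorants of convex functions *)

Definition convex_fun (R : realType) (V : lmodType R) (g : V -> R) :=
  forall (s : R) v w, 0 <= s <= 1 ->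
    g (s *: v + (1 - s) *: w) <= s * g v + (1 - s) * g w.

Section HahnBanach.
Variables (R : realType) (V : lmodType R).
Implicit Types (g q r : V -> R) (v w x y : V).

Lemma convex_ge_opp q x : convex_fun q -> q 0 = 0 -> - q (- x) <= q x.
Proof.
move=> qc q0; have h01 : 0 <= (2^-1 : R) <= 1 by lra.
have := qc 2^-1 x (- x) h01.
have -> : 1 - 2^-1 = 2^-1 :> R by lra.
rewrite scalerN subrr q0; lra.
Qed.

(** The last hypothesis lets one member of the family play the role of two;
    it holds for a chain of convex functions and for the translates used in
    [minimal_convex_additive]. *)
Lemma convex_inf (I : Type) (D : set I) (h : I -> V -> R) :
    D !=set0 ->
    (forall v, has_lbound [set h i v | i in D]) ->
    (forall i j s v w, D i -> D j -> 0 <= s <= 1 ->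
      exists2 l, D l &
        h l (s *: v + (1 - s) *: w) <= s * h i v + (1 - s) * h j w) ->
  convex_fun (fun v => inf [set h i v | i in D]).
Proof.
move=> [i0 Di0] hlb dir s v w s01; apply/ler_addgt0Pr => e e0.
have hinf u : has_inf [set h i u | i in D].
  by split; [exists (h i0 u), i0 | exact: hlb].
have [_ [i Di <-] hi] := inf_adherent e0 (hinf v).
have [_ [j Dj <-] hj] := inf_adherent e0 (hinf w).
have [l Dl hl] := dir i j s v w Di Dj s01.
have : inf [set h i (s *: v + (1 - s) *: w) | i in D]
       <= h l (s *: v + (1 - s) *: w) by apply: ge_inf; [exact: hlb|exists l].
case/andP: s01 => s0 s1; nra.
Qed.

(** A convex function vanishing at 0 that is minimal among such functions is
    linear.  Each step below exhibits a convex function vanishing at 0 and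
    dominated by [q]; minimality turns the domination into an equality. *)
Section minimal.
Variable q : V -> R.
Hypotheses (qc : convex_fun q) (q0 : q 0 = 0).
Hypothesis qmin : forall r, convex_fun r -> r 0 = 0 ->
  (forall x, r x <= q x) -> forall x, q x <= r x.

Lemma minimal_convex_homogeneous (s : R) x : 0 < s -> q (s *: x) = s * q x.
Proof.
have small (t : R) z : 0 < t <= 1 -> q (t *: z) = t * q z.
  move=> /andP[t0 t1].
  have le u : q (t *: u) <= t * q u.
    have := qc u 0 (s := t); rewrite scaler0 addr0 q0 mulr0 addr0; apply.
    by rewrite (ltW t0) t1.
  apply/eqP; rewrite eq_le le /= -ler_pdivlMl //.
  apply: (qmin (r := fun u => t^-1 * q (t *: u))).
  - move=> a v w a01; rewrite scalerDr !scalerA !(mulrC t) -!scalerA.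
    have := qc (t *: v) (t *: w) a01; rewrite -(ler_pM2l (x := t^-1)) ?invr_gt0 //.
    by move=> /le_trans; apply; rewrite le_eqVlt; apply/orP; left; apply/eqP; ring.
  - by rewrite scaler0 q0 mulr0.
  - by move=> u; rewrite ler_pdivrMl.
move=> s0; have [s1|s1] := leP s 1; first by rewrite small ?s0.
have sn0 : s != 0 by rewrite gt_eqF.
rewrite -[in RHS](scalerK sn0 x) [in RHS]small ?mulrA ?divff ?mul1r //.
by rewrite invr_gt0 s0 invf_le1 // ltW.
Qed.

Lemma minimal_convex_subadditive x y : q (x + y) <= q x + q y.
Proof.
have h01 : 0 <= (2^-1 : R) <= 1 by lra.
have := qc (2 *: x) (2 *: y) h01.
have -> : 1 - 2^-1 = 2^-1 :> R by lra.
rewrite !scalerA mulVf // !scale1r !minimal_convex_homogeneous //; lra.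
Qed.

(** The competitor is the infimum over [t >= 0] of [q (u + t *: y) - t * q y]:
    comparing it with [q] at [t = 1] gives superadditivity. *)
Lemma minimal_convex_additive x y : q (x + y) = q x + q y.
Proof.
apply/eqP; rewrite eq_le minimal_convex_subadditive /=.
pose h (t : R) u := q (u + t *: y) - t * q y.
have hom (t : R) u : 0 <= t -> q (t *: u) = t * q u.
  rewrite le_eqVlt => /predU1P[<-|]; first by rewrite scale0r mul0r.
  exact: minimal_convex_homogeneous.
pose D := [set t : R | 0 <= t].
have D0 : D 0 by exact: lexx.
have lb u : has_lbound [set h t u | t in D].
  exists (- q (- u)) => _ [t Dt <-]; rewrite /h.
  have := minimal_convex_subadditive (u + t *: y) (- u).
  rewrite addrAC subrr add0r hom //; lra.
have hc : convex_fun (fun u => inf [set h t u | t in D]).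
  apply: convex_inf => // [|t1 t2 s v w Dt1 Dt2 s01]; first by exists 0.
  exists (s * t1 + (1 - s) * t2).
    by rewrite /D /= in Dt1 Dt2 *; nra.
  have := qc (v + t1 *: y) (w + t2 *: y) s01.
  rewrite !scalerDr !scalerA addrACA -scalerDl /h; lra.
have hq u : inf [set h t u | t in D] <= q u.
  apply: le_trans (ge_inf (lb u) _) _; first by exists 0.
  by rewrite /h scale0r mul0r addr0 subr0.
have h0 : inf [set h t 0 | t in D] = 0.
  rewrite (_ : [set h t 0 | t in D] = [set 0]) ?inf1 //.
  apply/seteqP; split=> [_ [t Dt <-]|_ ->] /=.
    by rewrite /h add0r hom // subrr.
  by exists 0 => //; rewrite /h add0r scale0r q0 mul0r subrr.
have := qmin hc h0 hq x.
have : inf [set h t x | t in D] <= q (x + y) - q y.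
  by apply: ge_inf; [exact: lb|exists 1; rewrite /D /= ?ler01 // /h scale1r mul1r].
lra.
Qed.

Lemma minimal_convex_scalable (a : R) x : q (a *: x) = a * q x.
Proof.
have [a0|a0|->] := ltgtP a 0; last by rewrite scale0r mul0r.
- have := minimal_convex_additive (a *: x) ((- a) *: x).
  rewrite -scalerDl subrr scale0r q0 (@minimal_convex_homogeneous (- a)) ?oppr_gt0 //; lra.
- exact: minimal_convex_homogeneous.
Qed.

End minimal.

(** Zorn's lemma applies because [convex_ge_opp] bounds every convex function
    below [g] that vanishes at 0 from below by [fun x => - g (- x)]. *)
Lemma exists_minimal_convex g : convex_fun g -> g 0 = 0 ->
  exists q, [/\ convex_fun q, q 0 = 0, forall x, q x <= g x &
    forall r, convex_fun r -> r 0 = 0 ->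
      (forall x, r x <= q x) -> forall x, q x <= r x].
Proof.
move=> gc g0.
pose P q := [/\ convex_fun q, q 0 = 0 & forall x, q x <= g x].
pose le (q1 q2 : {q | P q}) := `[< forall x, sval q2 x <= sval q1 x >].
have Pg : P g by split.
have [|r s t /asboolP rs /asboolP st|A Atot|[q [qc q0 qg]] qmax] :=
  ZL_preorder (exist P g Pg) (R := le).
- by move=> t; apply/asboolP.
- by apply/asboolP => x; exact: le_trans (rs x).
- have [[q0 Aq0]|A0] := pselect (A !=set0); last first.
    by exists (exist P g Pg) => s As; case: A0; exists s.
  have lb v : has_lbound [set sval q v | q in A].
    exists (- g (- v)) => _ [[q [qc q00 qg]] /= Aq <-].
    by apply: le_trans (convex_ge_opp _ qc q00); rewrite lerN2.
  have Pinf : P (fun v => inf [set sval q v | q in A]).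
    split.
    + apply: convex_inf => //; first by exists q0.
      move=> i j s v w Ai Aj /[dup] s01 /andP[s0 s1].
      have [/asboolP ij|/asboolP ji] := Atot _ _ Ai Aj.
        exists j => //; apply: le_trans (_ : s * sval j v + (1 - s) * sval j w <= _).
          by case: (svalP j) => jc _ _; exact: jc.
        by rewrite lerD2r ler_wpM2l.
      exists i => //; apply: le_trans (_ : s * sval i v + (1 - s) * sval i w <= _).
        by case: (svalP i) => ic _ _; exact: ic.
      by rewrite lerD2l ler_wpM2l ?subr_ge0.
    + rewrite (_ : [set sval q 0 | q in A] = [set 0]) ?inf1 //.
      apply/seteqP; split=> [_ [[q [qc q00 qg]] /= Aq <-] //|_ ->] /=.
      by exists q0 => //; case: (svalP q0).
    + move=> x; apply: le_trans (ge_inf (lb x) _) _; first by exists q0.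
      by case: (svalP q0).
  exists (exist P _ Pinf) => s As; apply/asboolP => x /=.
  by apply: ge_inf; [exact: lb|exists s].
- exists q; split => // r rc r0 rq x.
  have Pr : P r by split=> // z; exact: le_trans (rq z) (qg z).
  have /qmax/asboolP : le (exist P q (And3 qc q0 qg)) (exist P r Pr).
    by apply/asboolP.
  exact.
Qed.

(** The Hahn-Banach theorem in the form of a subgradient at 0. *)
Lemma convex_minorant g : convex_fun g -> g 0 = 0 ->
  exists phi : {linear V -> R^o}, forall x, phi x <= g x.
Proof.
move=> gc g0; have [q [qc q0 qg qmin]] := exists_minimal_convex gc g0.
have ql : linear (q : V -> R^o).
  move=> a u v; rewrite (minimal_convex_additive qc q0 qmin).
  by rewrite (minimal_convex_scalable qc q0 qmin).
pose phi := GRing.isLinear.Build _ _ _ _ (q : V -> R^o) ql.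
pose Phi : {linear V -> R^o} := HB.pack (q : V -> R^o) phi.
by exists Phi.
Qed.

End HahnBanach.

(** * Diagonal selection along a filter *)

Section Selection.

Lemma filter_subseq_forall (T : eqType) (F : set_system T) (FF : Filter F)
    (P : seq T -> T -> Prop) (L : seq T) :
  (forall s, \forall j \near F, P s j) ->
  \forall j \near F, forall s, subseq s L -> P s j.
Proof.
move=> PF.
have := @filter_forall _ ((size L).-tuple bool) _ F FF (fun m => PF (mask m L)).
apply: filterS => j Pj s /subseqP[m sm ->].
by apply: (Pj (Tuple (introT eqP sm))).
Qed.

(** If a property of finite sequences survives appending almost every index,
    then it holds along all increasing sequences drawn from one infinite set
    of indices.  The set is built greedily: at each stage only the finitely
    many subsequences of the indices chosen so far constrain the next one. *)
Lemma increasing_selection (F : set_system nat) (FF : ProperFilter F)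
    (G : seq nat -> Prop) :
  (forall N, \forall j \near F, (N <= j)%N) ->
  G [::] -> (forall s, G s -> \forall j \near F, G (rcons s j)) ->
  exists j : nat -> nat, {homo j : m n / (m < n)%N} /\
    forall ns, sorted ltn ns -> G (map j ns).
Proof.
move=> Finf G0 Gstep.
pose good (L : seq nat) (n : nat) :=
  (\max_(i <- L) i < n)%N /\
  forall s, subseq s L -> G s -> G (rcons s n).
have ex L : exists n, good L n.
  apply: (@filter_ex _ F); apply: filterI; first exact: Finf.
  apply: filter_subseq_forall => s.
  have [Gs|nGs] := pselect (G s).
    by apply: filterS (Gstep s Gs).
  by apply: filterE.
have [sel selP] := choice ex.
pose build n := iter n (fun L => rcons L (sel L)) [::].
pose j n := sel (build n).
have buildE n : build n = map j (iota 0 n).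
  elim: n => // n IH; rewrite [build _]/= -/(build n) {1}IH.
  by rewrite -addn1 iotaD map_cat /= cats1.
have jincr : {homo j : m n / (m < n)%N}.
  move=> m n mn; have [+ _] := selP (build n); apply: leq_ltn_trans.
  apply: (@leq_bigmax_seq _ _ predT id) => //.
  by rewrite buildE; apply: map_f; rewrite mem_iota.
exists j; split => // ns; elim/last_ind: ns => // ns n IH srt.
have srt' : sorted ltn ns.
  by move: srt; apply: (subseq_sorted ltn_trans); exact: subseq_rcons.
rewrite map_rcons; have [_] := selP (build n); apply; last exact: IH.
rewrite buildE; apply: map_subseq.
have lt i : i \in ns -> (i < n)%N.
  move=> ins; have := srt; rewrite -cats1 (sorted_pairwise ltn_trans) pairwise_cat.
  by case/and3P => /allP/(_ i ins) /=; rewrite andbT.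
suff -> : ns = [seq i <- iota 0 n | i \in ns] by exact: filter_subseq.
apply: (irr_sorted_eq ltn_trans ltnn) => //.
  by apply: sorted_filter; [exact: ltn_trans|exact: iota_ltn_sorted].
by move=> i; rewrite mem_filter mem_iota /= add0n; case: (boolP (i \in ns)) => // /lt ->.
Qed.

End Selection.

(** * Limits of convex functions along weakly null perturbations *)

Section TailLimit.
Variables (R : realType) (X : normedModType R) (U : set_system nat).
Hypothesis UU : UltraFilter U.
Hypothesis Uinf : \oo `<=` U.

Lemma ultra_bounded_cvg (g : nat -> R) (B : R) :
  (forall j, `|g j| <= B) -> cvg (g j @[j --> U]).
Proof.
move=> gB.
have [|l [_ cl]] := @segment_compact R (- B) B (g @ U).
  apply: (@filterS _ U _ setT); last exact: filterT.
  by move=> j _ /=; rewrite in_itv /= -ler_norml.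
apply/cvg_ex; exists l.
move=> V /= Vl; have [//|UC] := in_ultra_setVsetC (g @^-1` V) UU.
by have [x [/= xC xV]] := cl (~` V) V UC Vl.
Qed.

(** The class of functions in which the iterated limits live: it contains the
    norm and is stable under [tail_lim].  The Lipschitz bound makes
    [g (v + u j)] bounded in [j], hence convergent along the ultrafilter. *)
Definition convex_contraction (g : X -> R) :=
  convex_fun g /\ forall v w, g v <= g w + `|v - w|.

Lemma convex_contraction_norm : convex_contraction (fun v : X => `|v|).
Proof.
split=> [s v w /andP[s0 s1]|v w].
  apply: le_trans (ler_normD _ _) _.
  by rewrite !normrZ (ger0_norm s0) ger0_norm // subr_ge0.
by rewrite addrC -lerBlDr; exact: lerB_dist.
Qed.

Definition tail_lim (u : nat -> X) (g : X -> R) : X -> R :=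
  fun v => lim (g (v + u j) @[j --> U]).

Variables (u : nat -> X) (B : R).
Hypothesis uB : forall j, `|u j| <= B.

Lemma cvg_tail_lim g v : convex_contraction g ->
  g (v + u j) @[j --> U] --> tail_lim u g v.
Proof.
move=> [_ gL]; apply: (@ultra_bounded_cvg _ (`|g v| + B)) => j.
have h1 := gL (v + u j) v; have h2 := gL v (v + u j).
rewrite opprD addNKr normrN in h2; rewrite [v + u j - v]addrC addKr in h1.
have h3 := uB j.
have := ler_norm (g v); have := ler_norm (- g v); rewrite normrN => h4 h5.
rewrite ler_norml.
by apply/andP; split; lra.
Qed.

Lemma tail_lim_contraction g :
  convex_contraction g -> convex_contraction (tail_lim u g).
Proof.
move=> gC; have gcv v := @cvg_tail_lim g v gC; case: (gC) => gc gL; split.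
  move=> s v w s01.
  apply: (ler_cvg_to (gcv _)).
    by apply: cvgD; (apply: cvgM; [exact: cvg_cst|exact: gcv]).
  near=> j => /=.
  have -> : s *: v + (1 - s) *: w + u j = s *: (v + u j) + (1 - s) *: (w + u j).
    by rewrite !scalerDr addrACA -scalerDl [s + _]addrC subrK scale1r.
  exact: gc.
move=> v w; apply: (ler_cvg_to (gcv _)).
  by apply: cvgD; [exact: gcv|exact: cvg_cst].
near=> j => /=; have := gL (v + u j) (w + u j).
by rewrite opprD addrACA subrr addr0.
Unshelve. all: by end_near. Qed.

Lemma tail_lim_mono g h : convex_contraction g -> convex_contraction h ->
  (forall v, g v <= h v) -> forall v, tail_lim u g v <= tail_lim u h v.
Proof.
move=> gC hC gh v; apply: (ler_cvg_to (@cvg_tail_lim g v gC) (@cvg_tail_lim h v hC)).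
by near=> j; exact: gh.
Unshelve. all: by end_near. Qed.

(** Weak lower semicontinuity of convex functions: the affine minorant
    [g v + phi] of [g] at [v] satisfies [phi (u j) --> 0]. *)
Lemma le_tail_lim g v : weakly_null u -> convex_contraction g ->
  g v <= tail_lim u g v.
Proof.
move=> u0 gC; have [gc gL] := gC.
pose h x := g (v + x) - g v.
have hc : convex_fun h.
  move=> s x y s01; have := gc s (v + x) (v + y) s01.
  rewrite !scalerDr addrACA -scalerDl [s + _]addrC subrK scale1r /h; lra.
have [|phi phih] := convex_minorant hc; first by rewrite /h addr0 subrr.
have phiN x : phi x <= `|x|.
  have := gL (v + x) v; rewrite [v + x - v]addrAC subrr add0r /h => ?.
  by have := phih x; rewrite /h; lra.
have phic : continuous phi.
  apply: bounded_linear_continuous; apply/linear_boundedP.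
  exists 1; split=> // M M1 x; apply: (@le_trans _ _ `|x|).
    rewrite ler_norml phiN andbT lerNl -linearN.
    by apply: le_trans (phiN _) _; rewrite normrN.
  by rewrite ler_peMl // ltW.
rewrite -[g v]addr0.
apply: (ler_cvg_to (a := U) (f := fun j => g v + phi (u j)) _ (@cvg_tail_lim g v gC)).
  apply: cvgD; first exact: cvg_cst.
  by move=> A /(u0 phi phic)/Uinf.
by near=> j; have := phih (u j); rewrite /h; lra.
Unshelve. all: by end_near. Qed.

End TailLimit.

(** * Suppression unconditionality of weakly null families *)

Section Suppression.
Variables (R : realType) (X : normedModType R) (T : finType).
Variables (u : T -> nat -> X) (B : R).
Hypothesis uB : forall t j, `|u t j| <= B.
Hypothesis u0 : forall t, weakly_null (u t).

Section IteratedLimit.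
Variable U : set_system nat.
Hypothesis UU : UltraFilter U.
Hypothesis Uinf : \oo `<=` U.

(** For [W = t_1 ... t_n], the value at [v] is the limit of
    [`|v + u t_1 j_1 + ... + u t_n j_n|], taken in [j_n] first and in [j_1]
    last. *)
Definition iter_lim (W : seq T) : X -> R :=
  foldr (fun t g => tail_lim U (u t) g) (fun v => `|v|) W.

Lemma iter_lim_contraction W : convex_contraction (iter_lim W).
Proof.
elim: W => [|t W IH] /=; first exact: convex_contraction_norm.
exact: (tail_lim_contraction UU (uB t)).
Qed.

Lemma iter_lim_mask b W v : iter_lim (mask b W) v <= iter_lim W v.
Proof.
elim: W b v => [|t W IH] b v; first by rewrite mask0.
have drop_head : iter_lim W v <= iter_lim (t :: W) v.
  exact: (le_tail_lim UU Uinf (uB t) _ (u0 t) (iter_lim_contraction W)).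
case: b => [|[] b] /=.
- exact: le_trans (IH [::] v) drop_head.
- apply: (tail_lim_mono UU (uB t)); [exact: iter_lim_contraction..|exact: IH].
- exact: le_trans (IH b v) drop_head.
Qed.

(** Letters of [W] beyond the length of [s] are dropped by [zip]; thus, while
    [s] is being built, this is the sum of the terms chosen so far. *)
Definition word_sum (W : seq T) (s : seq nat) : X :=
  \sum_(l <- zip W s) u l.1 l.2.

Lemma word_sum_rcons W t W' s j : size s = size W ->
  word_sum (W ++ t :: W') (rcons s j) = word_sum (W ++ t :: W') s + u t j.
Proof.
move=> sW; rewrite /word_sum -cats1 -[X in _ = \sum_(l <- zip _ X) _ + _]cats0.
rewrite !zip_cat // !big_cat /= big_cons /=.
by case: W' => [|? ?]; rewrite !big_nil !addr0.
Qed.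

(** The selected property of [s] says that replacing the first [size s] limits
    by the actual indices [s] changes the iterated limit by at most
    [size s * e], for each of the finitely many words of length at most [n].
    The definition of [tail_lim] as a limit gives the inductive step. *)
Lemma iter_lim_approx (n : nat) (d : R) : 0 < d ->
  exists j : nat -> nat, {homo j : m n / (m < n)%N} /\
    forall W ns, (size W <= n)%N -> size ns = size W -> sorted ltn ns ->
      `| `|word_sum W (map j ns)| - iter_lim W 0| <= d.
Proof.
move=> d0.
pose e := d / n.+1%:R.
have e0 : 0 < e by rewrite divr_gt0.
pose G (s : seq nat) := forall (q : 'I_n.+1) (W : q.-tuple T),
  (size s <= size W)%N ->
  `|iter_lim (drop (size s) W) (word_sum W s) - iter_lim W 0|
     <= (size s)%:R * e.
have G0 : G [::].
  move=> q W _ /=; rewrite drop0 /word_sum.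
  case: (val W) => [|? ?]; rewrite big_nil subrr normr0; lra.
have Uge N : \forall j \near U, (N <= j)%N by apply: Uinf; exact: nbhs_infty_ge.
have Gstep s : G s -> \forall j \near U, G (rcons s j).
  move=> Gs; apply: filter_forall => q; apply: filter_forall => W.
  have [sW|Ws] := ltnP (size s) (size W); last first.
    by apply: filterE => j; rewrite size_rcons ltnNge Ws.
  have := Gs q W (ltnW sW).
  have t0 : T by case: (val W) sW.
  rewrite (drop_nth t0 sW) /=.
  set t := nth t0 W (size s); set D := drop _ _; set v := word_sum _ _ => Gv.
  have /cvgrPdist_le/(_ e e0) := @cvg_tail_lim _ _ _ UU _ _ (uB t) _ v
    (iter_lim_contraction D).
  apply: filterS => j jv _; rewrite size_rcons.
  have -> : word_sum W (rcons s j) = v + u t j.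
    rewrite /v -{1 2}(cat_take_drop (size s) W) (drop_nth t0 sW).
    by apply: word_sum_rcons; rewrite size_takel // ltnW.
  rewrite -natr1 mulrDl mul1r.
  apply: le_trans (ler_distD (tail_lim U (u t) (iter_lim D) v) _ _) _.
  by rewrite addrC lerD // distrC.
have [j [jincr jG]] := increasing_selection _ Uge G0 Gstep.
exists j; split => // W ns Wn nsW srt.
have := jG ns srt (inord (size W))
  (tcast (esym (inordK (Wn : (size W < n.+1)%N))) (in_tuple W)).
rewrite val_tcast /= size_map nsW leqnn drop_size => /(_ isT) /le_trans; apply.
rewrite /e mulrCA ger_pMr // ler_pdivrMr // mul1r ler_nat.
exact: leq_trans (leqnSn n).
Qed.

End IteratedLimit.

(** The bound on the length of the sums cannot be dropped: some normalized
    weakly null sequences have no unconditional subsequence. *)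
Lemma finite_suppression_unconditional (n : nat) (d : R) : 0 < d ->
  exists j : nat -> nat, {homo j : m n / (m < n)%N} /\
    forall (L : seq (T * nat)) (P : pred (T * nat)),
      (size L <= n)%N -> sorted ltn (unzip2 L) ->
      `|\sum_(l <- L | P l) u l.1 (j l.2)|
        <= `|\sum_(l <- L) u l.1 (j l.2)| + d.
Proof.
move=> d0.
have [U [UU Uinf]] := ultraFilterLemma eventually_filter.
have [|j [jincr japprox]] := iter_lim_approx UU Uinf n (d := d / 2).
  by rewrite divr_gt0.
exists j; split => // L P Ln srt.
have sumE (K : seq (T * nat)) :
    \sum_(l <- K) u l.1 (j l.2) = word_sum (unzip1 K) (map j (unzip2 K)).
  rewrite /word_sum; elim: K => [|l K IH]; first by rewrite !big_nil.
  by rewrite /= !big_cons IH.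
rewrite -big_filter !sumE.
have srtP : sorted ltn (unzip2 [seq l <- L | P l]).
  apply: (subseq_sorted ltn_trans) srt; exact: map_subseq (filter_subseq _ _).
have szP : (size [seq l <- L | P l] <= n)%N.
  by apply: leq_trans Ln; rewrite size_filter count_size.
have := japprox (unzip1 L) (unzip2 L); rewrite !size_map => /(_ Ln erefl srt).
have := japprox (unzip1 [seq l <- L | P l]) (unzip2 [seq l <- L | P l]).
rewrite !size_map => /(_ szP erefl srtP).
have := iter_lim_mask UU Uinf (map P L) (unzip1 L) 0.
rewrite /unzip1 -map_mask -filter_mask !ler_norml.
move=> h1 /andP[h2 h3] /andP[h4 h5]; lra.
Qed.

End Suppression.

(** * The weights *)

Section Weights.
Variables (R : realType) (p : R) (f : R -> R).
Hypothesis hp : 1 <= p.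
Hypothesis f_ge0 : forall t, 0 <= t -> 0 <= f t.
Hypothesis f_incr : forall s t, 0 <= s -> s <= t -> f s <= f t.

Let p0 : 0 < p. Proof. exact: lt_le_trans hp. Qed.
Let ip0 : 0 <= p^-1. Proof. by rewrite invr_ge0 ltW. Qed.

Lemma powRVK (x : R) : 0 <= x -> (x `^ p^-1) `^ p = x.
Proof. by move=> x0; rewrite -powRrM mulVf ?gt_eqF // powRr1. Qed.

Lemma powRKV (x : R) : 0 <= x -> (x `^ p) `^ p^-1 = x.
Proof. by move=> x0; rewrite -powRrM mulfV ?gt_eqF // powRr1. Qed.

(** This is [f i / i `^ (1 + 1 / p)], with the two powers of [i] kept apart so
    that raising to the power [p] gives [(f i / i) `^ p / i]. *)
Definition increment (i : nat) : R := f i%:R / i%:R * i%:R^-1 `^ p^-1.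

Definition weight (j : nat) : R := 1 + \sum_(1 <= i < j.+1) increment i.

Lemma increment_ge0 i : 0 <= increment i.
Proof. by rewrite !mulr_ge0 ?powR_ge0 ?invr_ge0 ?f_ge0. Qed.

Lemma weight_ge1 j : 1 <= weight j.
Proof. by rewrite lerDl sumr_ge0 // => i _; exact: increment_ge0. Qed.

Lemma weight0 : weight 0 = 1.
Proof. by rewrite /weight big_geq // addr0. Qed.

Lemma weightS j : weight j.+1 = weight j + increment j.+1.
Proof. by rewrite /weight big_nat_recr //= addrA. Qed.

Lemma weight_mono i j : (i <= j)%N -> weight i <= weight j.
Proof.
elim: j => [|j IH]; first by rewrite leqn0 => /eqP ->.
rewrite leq_eqVlt => /predU1P[->//|/IH/le_trans]; apply.
by rewrite weightS lerDl increment_ge0.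
Qed.

Lemma increment_powR i : increment i `^ p = (f i%:R / i%:R) `^ p / i%:R.
Proof.
rewrite /increment powRM ?powR_ge0 ?powRVK ?invr_ge0 //.
by rewrite mulr_ge0 ?invr_ge0 ?f_ge0.
Qed.

(** Without its constant, the right-hand side bounds [(f t / t) `^ p / t] from
    below for [t] between [i] and [i.+1]; the constant comes from
    [i.+1 <= 2 * i]. *)
Lemma increment_powR_le i : (0 < i)%N -> increment i `^ p
  <= 2 `^ p * 2 * ((f i%:R / i.+1%:R) `^ p / i.+1%:R).
Proof.
move=> i0; rewrite increment_powR.
have fi0 : 0 <= f i%:R by exact: f_ge0.
have i1 : (1 : R) <= i%:R by rewrite (ler_nat _ 1).
have iV : i%:R^-1 <= 2 * i.+1%:R^-1 :> R.
  rewrite -natr1 ler_pdivlMr ?ler_pdivrMl; lra.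
rewrite mulrACA -powRM ?mulr_ge0 ?invr_ge0 //.
apply: ler_pM => //; rewrite ?invr_ge0 ?powR_ge0 //.
apply: ge0_ler_powR; rewrite ?nnegrE ?mulr_ge0 ?invr_ge0 //; first exact: ltW.
by rewrite mulrCA ler_wpM2l.
Qed.

Let g (t : R) := (f t / t) `^ p / t.

(** On the half-line, [f] and the inverse agree with monotone functions on the
    whole real line, obtained by precomposing with [Num.max 1]. *)
Lemma measurable_integrand (D : set R) :
  measurable D -> D `<=` `[1%R, +oo[%classic ->
  measurable_fun D (EFin \o g).
Proof.
move=> mD D1.
pose fm (t : R) := f (Num.max 1 t).
pose im (t : R) := (Num.max 1 t)^-1.
have mono (s t : R) : s <= t -> Num.max 1 s <= Num.max 1 t.
  by move=> st; rewrite ge_max !le_max lexx st orbT.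
have max0 (s : R) : 0 < Num.max 1 s by rewrite lt_max ltr01.
have mf : measurable_fun D fm.
  apply: nondecreasing_measurable => // s t st.
  by apply: f_incr; [exact: ltW|exact: mono].
have mi : measurable_fun D im.
  apply: nonincreasing_measurable => // s t st.
  by rewrite lef_pV2 ?posrE //; exact: mono.
apply/measurable_EFinP.
apply: (eq_measurable_fun (fun t => ((fm t * im t) `^ p * im t))).
  move=> t; rewrite inE => /D1 /=; rewrite in_itv /= andbT => t1.
  by rewrite /fm /im /g max_r.
apply: measurable_funM => //.
apply: (measurableT_comp (measurable_powR p)).
exact: measurable_funM.
Qed.

Lemma integrand_ge0 t : 1 <= t -> (0 <= (g t)%:E)%E.
Proof.
by move=> t1; rewrite lee_fin mulr_ge0 ?powR_ge0 // invr_ge0; lra.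
Qed.

Lemma sum_le_integral n : (0 < n)%N ->
  ((\sum_(1 <= i < n) (f i%:R / i.+1%:R) `^ p / i.+1%:R)%:E
   <= \int[lebesgue_measure]_(t in `[1%R, n%:R[) (g t)%:E)%E.
Proof.
case: n => // n _; elim: n => [|n IH].
  rewrite big_geq //; apply: integral_ge0 => t /=.
  by rewrite in_itv /= => /andP[t1 _]; exact: integrand_ge0.
rewrite big_nat_recr //= EFinD.
have n1 : (1 : R) <= n.+1%:R by rewrite (ler_nat _ 1).
have n12 : (n.+1%:R : R) < n.+2%:R by rewrite ltr_nat.
have -> : `[1%R, n.+2%:R[%classic =
    `[1%R, n.+1%:R[%classic `|` `[n.+1%:R, n.+2%:R[%classic :> set R.
  apply/seteqP; split => t /=; rewrite !in_itv /=.
    move=> /andP[t1 t2]; have [|] := ltP t n.+1%:R; rewrite ?t1 ?t2; first by left.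
    by right.
  by move=> [|] /andP[a b]; apply/andP; split; lra.
have sub1 : `[1%R, n.+1%:R[%classic `|` `[n.+1%:R, n.+2%:R[%classic
    `<=` (`[1%R, +oo[%classic : set R).
  by move=> t [|] /=; rewrite !in_itv /= andbT => /andP[]; lra.
rewrite ge0_integral_setU //; last 3 first.
- by apply: measurable_integrand => //; exact: measurableU.
- by move=> t /sub1 /=; rewrite in_itv /= andbT; exact: integrand_ge0.
- apply/disj_setPS => t [] /=; rewrite !in_itv /=; lra.
apply: leeD => //.
pose c := (f n.+1%:R / n.+2%:R) `^ p / n.+2%:R.
have c0 : 0 <= c by rewrite mulr_ge0 ?powR_ge0 ?invr_ge0.
have -> : c%:E = (\int[lebesgue_measure]_(t in `[n.+1%:R, n.+2%:R[) (cst c%:E) t)%E.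
  have mu1 : lebesgue_measure (`[n.+1%:R, n.+2%:R[%classic : set R) = 1%E.
    rewrite lebesgue_measure_itv /= lte_fin n12 -EFinD.
    by congr EFin; rewrite -[n.+2%:R]natr1; ring.
  rewrite integral_cst //; apply/esym.
  exact: etrans (congr1 (fun y => c%:E * y)%E mu1) (mule1 _).
apply: ge0_le_integral => //.
- by apply: measurable_integrand => //; apply: subset_trans sub1; exact: subsetUr.
- move=> t /=; rewrite in_itv /= => /andP[t1 t2]; rewrite lee_fin.
  have t0 : 0 < t by lra.
  have tV : n.+2%:R^-1 <= t^-1 by rewrite lef_pV2 ?posrE //; lra.
  have ff : f n.+1%:R <= f t by apply: f_incr.
  apply: ler_pM; rewrite ?powR_ge0 ?invr_ge0 //.
  apply: ge0_ler_powR; rewrite ?nnegrE ?mulr_ge0 ?invr_ge0 ?f_ge0 //; try exact: ltW.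
  by apply: ler_pM; rewrite ?invr_ge0 ?f_ge0.
Qed.

Lemma increment_summable :
  (\int[lebesgue_measure]_(t in `[1%R, +oo[) ((f t / t) `^ p / t)%:E < +oo)%E ->
  exists C : R, forall n, \sum_(1 <= i < n) increment i `^ p <= C.
Proof.
move=> f_int; set I := (\int[_]_(t in _) _)%E in f_int.
have I0 : (0 <= I)%E.
  apply: integral_ge0 => t /=; rewrite in_itv /= andbT; exact: integrand_ge0.
have IE : I = (fine I)%:E by rewrite fineK // ge0_fin_numE.
have fI0 : 0 <= fine I by rewrite fine_ge0.
have c0 : 0 <= 2 `^ p * 2 :> R by rewrite mulr_ge0 ?powR_ge0.
exists (2 `^ p * 2 * fine I).
case=> [|n]; first by rewrite big_geq // mulr_ge0.
apply: le_trans (_ : 2 `^ p * 2 *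
  \sum_(1 <= i < n.+1) (f i%:R / i.+1%:R) `^ p / i.+1%:R <= _).
  rewrite mulr_sumr !big_nat; apply: ler_sum => i /andP[i1 _].
  exact: increment_powR_le.
rewrite ler_wpM2l // -lee_fin -IE.
apply: le_trans (sum_le_integral _) _ => //.
apply: ge0_subset_integral => //.
- exact: measurable_integrand.
- by move=> t /=; rewrite in_itv /= andbT; exact: integrand_ge0.
- by move=> t /=; rewrite !in_itv /= andbT => /andP[].
Qed.

(** The increments of index between [a / 4] and [j] are each at least
    [f (a / 4) / a] times the [p]-th root of [1 / a], and there are at least
    [a / 4] of them when [2 * j >= a]. *)
Lemma weight_ge (a j : nat) : (a <= j.*2)%N -> (j < a)%N ->
  f (a%:R / 4) / 4 * a%:R^-1 `^ p^-1 <= weight j.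
Proof.
move=> aj ja.
have a0 : (0 < a)%N by lia.
have a0R : 0 < a%:R :> R by rewrite ltr0n.
set m := ((a + 3) %/ 4)%N.
have m1 : (1 <= m)%N by lia.
have mj : (m <= j.+1)%N by lia.
pose e := f (a%:R / 4) / a%:R * a%:R^-1 `^ p^-1.
have e0 : 0 <= e by rewrite !mulr_ge0 ?powR_ge0 ?invr_ge0 ?f_ge0 // divr_ge0.
have eh i : (m <= i < j.+1)%N -> e <= increment i.
  move=> /andP[mi ij].
  have ia : i%:R <= a%:R :> R by rewrite ler_nat; lia.
  have i0 : 0 < i%:R :> R by rewrite ltr0n; lia.
  have iV : a%:R^-1 <= i%:R^-1 :> R by rewrite lef_pV2.
  apply: ler_pM; rewrite ?powR_ge0 ?mulr_ge0 ?invr_ge0 ?f_ge0 ?divr_ge0 //.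
    apply: ler_pM; rewrite ?powR_ge0 ?mulr_ge0 ?invr_ge0 ?f_ge0 ?divr_ge0 //.
    apply: f_incr; first by rewrite divr_ge0.
    by rewrite ler_pdivrMr // -natrM ler_nat; lia.
  by apply: ge0_ler_powR; rewrite ?nnegrE ?invr_ge0 ?(ltW p0).
rewrite /weight (big_cat_nat (n := m)) //=.
have : \sum_(m <= i < j.+1) e <= \sum_(m <= i < j.+1) increment i.
  by rewrite !big_nat; apply: ler_sum.
rewrite sumr_const_nat -[e *+ _]mulr_natl.
have : 0 <= \sum_(1 <= i < m) increment i.
  by apply: sumr_ge0 => i _; exact: increment_ge0.
have : f (a%:R / 4) / 4 * a%:R^-1 `^ p^-1 <= (j.+1 - m)%:R * e.
  have -> : f (a%:R / 4) / 4 * a%:R^-1 `^ p^-1 = (a%:R / 4) * e.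
    by rewrite /e; field; rewrite gt_eqF.
  by rewrite ler_wpM2r // ler_pdivrMr // -natrM ler_nat; lia.
move=> h1 h2 h3; apply: le_trans h1 (le_trans h3 _).
by rewrite addrA lerDr addr_ge0.
Qed.

Lemma weight_sum_ge1 (a : nat) : (0 < a)%N ->
  1 <= (\sum_(i < a) weight i `^ p) `^ p^-1.
Proof.
have one (r : R) : 1 `^ r = 1 :> R by rewrite powR1.
case: a => // a _; rewrite -[X in X <= _](one p^-1).
have w1 i : 1 <= weight i `^ p.
  by rewrite -[X in X <= _](one p); apply: ge0_ler_powR;
    rewrite ?nnegrE ?(ltW p0) ?weight_ge1 // (le_trans _ (weight_ge1 _)).
have s0 : 0 <= \sum_(i < a) weight (lift ord0 i) `^ p.
  by apply: sumr_ge0 => i _; exact: powR_ge0.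
apply: ge0_ler_powR; rewrite ?nnegrE //; rewrite big_ord_recl /=;
  by have := w1 0%N; lra.
Qed.

(** [weight_ge] applies to the indices [j] in the upper half of [0, ..., a.-1],
    and for [a >= 2] there are at least [a / 4] of these. *)
Lemma weight_sum_ge (a : nat) : (1 < a)%N ->
  f (a%:R / 4) / 16 <= (\sum_(i < a) weight i `^ p) `^ p^-1.
Proof.
move=> a1.
have a0R : 0 < a%:R :> R by rewrite ltr0n; lia.
set h := f (a%:R / 4).
have h0 : 0 <= h by rewrite f_ge0 // divr_ge0.
have sumw : (h / 4) `^ p / 4 <= \sum_(i < a) weight i `^ p.
  rewrite -(big_mkord predT (fun i => weight i `^ p)).
  rewrite (big_cat_nat (n := uphalf a)) //=; last lia.
  have : 0 <= \sum_(0 <= i < uphalf a) weight i `^ p.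
    by apply: sumr_ge0 => i _; exact: powR_ge0.
  have : \sum_(uphalf a <= i < a) (h / 4) `^ p / a%:R
         <= \sum_(uphalf a <= i < a) weight i `^ p.
    rewrite !big_nat; apply: ler_sum => i /andP[i1 i2].
    rewrite -[a%:R^-1]powRVK ?invr_ge0 // -powRM ?powR_ge0 ?divr_ge0 //.
    apply: ge0_ler_powR; rewrite ?nnegrE ?mulr_ge0 ?powR_ge0 ?invr_ge0 //.
    - exact: ltW.
    - exact: le_trans (weight_ge1 _).
    - by apply: weight_ge; lia.
  rewrite sumr_const_nat -[_ *+ (a - _)]mulr_natl.
  have : (h / 4) `^ p / 4 <= (a - uphalf a)%:R * ((h / 4) `^ p / a%:R).
    have -> : (h / 4) `^ p / 4 = a%:R / 4 * ((h / 4) `^ p / a%:R).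
      by field; rewrite gt_eqF.
    rewrite ler_wpM2r ?divr_ge0 ?powR_ge0 //.
    by rewrite ler_pdivrMr // -natrM ler_nat; lia.
  lra.
apply: (@le_trans _ _ (((h / 4) `^ p / 4) `^ p^-1)).
  rewrite powRM ?powR_ge0 ?invr_ge0 // powRKV ?divr_ge0 //.
  have : 4^-1 <= 4^-1 `^ p^-1 :> R.
    by apply: ger1_powR; [lra|rewrite invf_le1].
  by move=> /(ler_wpM2l (divr_ge0 h0 (ler0n _ 4))); lra.
apply: ge0_ler_powR; rewrite ?nnegrE ?divr_ge0 ?powR_ge0 //.
by apply: sumr_ge0 => i _; exact: powR_ge0.
Qed.

End Weights.

(** * The asymptotic model with few rows and large coefficients *)

Section Asymptotic.
Variables (R : realType) (p : R) (X : normedModType R) (x : nat -> nat -> X).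
Hypothesis hp : 1 <= p.

(** The defining estimate concerns exactly [N] rows and coefficients in
    [[-1, 1]].  Dividing by [B] and adding zero coefficients in the rows from
    [r] to [N.-1] reduces the present situation to it, at the cost of the error
    [B * eps N], which is small for large [N]. *)
Lemma asymptotic_model_estimate : generates_lp_asymptotic_model p x ->
  forall (M : nat) (B d : R), 0 < B -> 0 < d -> exists N, (M <= N)%N /\
    forall r (a : nat -> R) (k : nat -> nat),
    (r <= N)%N ->
    (forall i, (i < r)%N -> `|a i| <= B) ->
    (forall i, (i < r)%N -> (N <= k i)%N) ->
    (forall i j, (i < j < r)%N -> (k i < k j)%N) ->
    `| `|\sum_(i < r) a i *: x i (k i)|
       - (\sum_(i < r) `|a i| `^ p) `^ p^-1 | <= d.
Proof.
move=> [_ [eps [eps01 /cvgrPdist_lt eps0 model]]] M B d B0 d0.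
have dB0 : 0 < d / B by rewrite divr_gt0.
have [N0 _ N0P] := eps0 _ dB0.
pose N := maxn M N0.
have epsN : eps N < d / B.
  have := N0P N (leq_maxr _ _); rewrite /= sub0r normrN => /(le_lt_trans _); apply.
  exact: ler_norm.
exists N; split; first exact: leq_maxl.
move=> r a k rN aB Nk kincr.
pose a' (i : nat) := if (i < r)%N then a i / B else 0.
pose K := \max_(i < r) k i.
pose k' (i : nat) := if (i < r)%N then k i else (K + N + i.+1)%N.
have kK i : (i < r)%N -> (k i <= K)%N.
  by move=> ir; exact: (leq_bigmax (F := fun i : 'I_r => k i) (Ordinal ir)).
(* The columns of the added rows lie beyond all the given ones. *)
have := model N (fun i => a' i) (fun i => k' i).
have -> : \sum_(i < N) a' i *: x i (k' i) = B^-1 *: \sum_(i < r) a i *: x i (k i).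
  rewrite (big_ord_widen N (fun i => a i *: x i (k i)) rN) scaler_sumr.
  rewrite [RHS]big_mkcond /=; apply: eq_bigr => i _; rewrite /a' /k'.
  by case: ifP => _; rewrite ?scale0r // mulrC scalerA.
have -> : \sum_(i < N) `|a' i| `^ p = B^-1 `^ p * \sum_(i < r) `|a i| `^ p.
  rewrite (big_ord_widen N (fun i => `|a i| `^ p) rN) mulr_sumr.
  rewrite [RHS]big_mkcond /=; apply: eq_bigr => i _; rewrite /a'.
  case: ifP => _; last by rewrite normr0 powR0 // gt_eqF // (lt_le_trans _ hp).
  by rewrite normrM normfV (gtr0_norm B0) powRM ?invr_ge0 ?(ltW B0) // mulrC.
have s0 : 0 <= \sum_(i < r) `|a i| `^ p by apply: sumr_ge0 => i _; exact: powR_ge0.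
rewrite powRM ?powR_ge0 // powRKV ?invr_ge0 ?(ltW B0) //.
rewrite normrZ normfV (gtr0_norm B0) -mulrBr normrM normfV (gtr0_norm B0).
move=> H; suff : B^-1 * `| `|\sum_(i < r) a i *: x i (k i)|
       - (\sum_(i < r) `|a i| `^ p) `^ p^-1 | <= d / B.
  by rewrite ler_pdivrMl // mulrCA divff ?mulr1 // lt0r_neq0.
apply: le_trans (ltW (H _ _ _)) (ltW epsN).
- move=> i; rewrite /a' -ler_norml; case: ifP => ir; last by rewrite normr0.
  by rewrite normrM normfV (gtr0_norm B0) ler_pdivrMr // mul1r aB.
- by move=> i; rewrite /k'; case: ifP => [/Nk //|_]; lia.
- move=> i j ij; rewrite /k'; case: ifP => ir; case: ifP => jr; try lia.
    by apply: kincr; rewrite ij.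
  by have := kK _ ir; lia.
Qed.

End Asymptotic.

(** * Initial segments of a vertex and their codes *)

Section Branches.

Definition branch (s : seq nat) : seq (seq nat) :=
  [seq take i.+1 s | i <- iota 0 (size s)].

Lemma size_branch s : size (branch s) = size s.
Proof. by rewrite size_map size_iota. Qed.

Lemma mem_branch (q s : seq nat) : (q \in branch s) = (q != [::]) && prefix q s.
Proof.
apply/mapP/andP => [[i]|[q0 /prefixP[r ->]]].
  rewrite mem_iota /= add0n => lis ->; split; last exact: prefix_take.
  by case: s lis.
exists (size q).-1; last first.
  by rewrite prednK ?take_size_cat // lt0n size_eq0.
by rewrite mem_iota /= add0n size_cat; case: (q) q0 => //= ? ? _; lia.
Qed.

Lemma branch_uniq s : uniq (branch s).
Proof.
rewrite map_inj_in_uniq ?iota_uniq // => i j; rewrite !mem_iota /= !add0n.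
by move=> li lj /(congr1 size); rewrite !size_takel // => -[].
Qed.

Lemma branch_size (q s : seq nat) : q \in branch s -> (0 < size q <= size s)%N.
Proof.
by rewrite mem_branch -size_eq0 -lt0n => /andP[-> /size_prefix].
Qed.

Lemma take_branch_lcp i s t : (i < size s)%N ->
  (take i.+1 s \in branch t) = (i < size (lcp s t))%N.
Proof.
move=> lis; rewrite mem_branch.
have -> : take i.+1 s != [::] by case: s lis.
apply/idP/idP => /= [pt|il].
  have := size_prefix (lcp_max (prefix_take s i.+1) pt).
  by rewrite size_takel.
apply: prefix_trans (prefix_lcpr s t).
have /prefixP[r E] := prefix_lcpl s t.
by rewrite {1}E takel_cat // prefix_take.
Qed.

(** The Goedel code of sequences increases along branches, so that it can
    number the columns: this is what the asymptotic model requires on each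
    single branch, while injectivity keeps the columns of two different
    vertices apart. *)
Lemma code_cat_lt s r : r != [::] -> (CodeSeq.code s < CodeSeq.code (s ++ r))%N.
Proof.
move=> r0; elim: s => [|m s IH] /=.
  by case: r r0 => //= m r _; rewrite muln_gt0 expn_gt0.
by rewrite ltn_pmul2l ?expn_gt0 // ltnS ltn_double.
Qed.

Lemma code_take_lt s i j : (i < j <= size s)%N ->
  (CodeSeq.code (take i s) < CodeSeq.code (take j s))%N.
Proof.
move=> /andP[ij js]; rewrite -(cat_take_drop i (take j s)) take_takel ?(ltnW ij) //.
apply: code_cat_lt; rewrite -size_eq0 size_drop size_takel //; lia.
Qed.

Lemma big_branch (V : nmodType) s (P : pred (seq nat)) (h : seq nat -> V) :
  \sum_(q <- branch s | P q) h q
  = \sum_(i < size s | P (take i.+1 s)) h (take i.+1 s).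
Proof.
rewrite big_map.
rewrite -(big_mkord (fun i => P (take i.+1 s)) (fun i => h (take i.+1 s))).
by rewrite /index_iota subn0.
Qed.

End Branches.

(** * The embedding *)

Section Embedding.
Variables (R : realType) (X : normedModType R) (x : nat -> nat -> X).
Variable w : nat -> R.

Definition embedding (node : seq nat -> nat) (s : seq nat) : X :=
  \sum_(q <- branch s) w (size s - size q) *: x (size q).-1 (node q).

Lemma embedding_ord node s : embedding node s =
  \sum_(i < size s) w (size s - i.+1) *: x i (node (take i.+1 s)).
Proof.
rewrite /embedding big_branch; apply: eq_bigr => i _.
by rewrite size_takel.
Qed.

Definition edge_coefficient (n i : nat) : R :=
  if (i < n)%N then w (n - i) - w (n - i.+1) else w 0.

Lemma embedding_step node s m :
  embedding node (rcons s m) - embedding node s =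
  \sum_(i < (size s).+1)
     edge_coefficient (size s) i *: x i (node (take i.+1 (rcons s m))).
Proof.
rewrite !embedding_ord size_rcons !big_ord_recr /= /edge_coefficient subnn ltnn.
rewrite addrAC -sumrB; congr (_ + _); apply: eq_bigr => i _.
rewrite subSS ltn_ord scalerBl.
by rewrite -cats1 [take i.+1 (s ++ _)]takel_cat.
Qed.

(** The coefficient of the difference of two images at a vertex [q] is
    [padded_weight a - padded_weight b], where [a] is one more than the depth of
    the first vertex below [q], or 0 if [q] is not on its branch, and [b] plays
    the same role for the second vertex.  Hence, at a fixed depth [k], only
    finitely many letters occur. *)
Definition padded_weight (a : nat) : R := if a is a'.+1 then w a' else 0.

Definition letter_vector (k : nat) (l : 'I_k.+1 * 'I_k.+1 * 'I_k.+1)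
    (n : nat) : X :=
  (padded_weight l.1.2 - padded_weight l.2) *: x l.1.1 n.

(** Suppressing from the difference of two images every vertex except those
    on the branch of [s] alone: listed by increasing code, the vertices of the
    two branches form a word of length at most [2 * k], to which the
    unconditionality hypothesis applies. *)
Lemma embedding_unshared_le (k N : nat) (j : nat -> nat) (d : R) :
  (forall (L : seq ('I_k.+1 * 'I_k.+1 * 'I_k.+1 * nat)) P,
     (size L <= k.*2)%N -> sorted ltn (unzip2 L) ->
     `|\sum_(l <- L | P l) letter_vector l.1 (j l.2)|
        <= `|\sum_(l <- L) letter_vector l.1 (j l.2)| + d) ->
  let node q := j (CodeSeq.code q + N)%N in
  forall s t, (size s <= k)%N -> (size t <= k)%N ->
    `|\sum_(q <- branch s | q \notin branch t)
        w (size s - size q) *: x (size q).-1 (node q)|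
     <= `|embedding node s - embedding node t| + d.
Proof.
move=> H node s t sk tk.
pose idx (v q : seq nat) := if q \in branch v then (size v - size q).+1 else 0%N.
pose le (q r : seq nat) := (CodeSeq.code q <= CodeSeq.code r)%N.
pose Q := sort le (undup (branch s ++ branch t)).
have memQ q : (q \in Q) = (q \in branch s) || (q \in branch t).
  by rewrite mem_sort mem_undup mem_cat.
have uniqQ : uniq Q by rewrite sort_uniq undup_uniq.
pose letter q : 'I_k.+1 * 'I_k.+1 * 'I_k.+1 :=
  (inord (size q).-1, inord (idx s q), inord (idx t q)).
pose L := [seq (letter q, (CodeSeq.code q + N)%N) | q <- Q].
have LP : (size L <= k.*2)%N.
  rewrite size_map size_sort; apply: leq_trans (size_undup _) _.
  by rewrite size_cat !size_branch -addnn leq_add.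
have Lsrt : sorted ltn (unzip2 L).
  rewrite /unzip2 -map_comp /=.
  have -> : map (snd \o (fun q => (letter q, (CodeSeq.code q + N)%N))) Q =
            map (fun n => n + N)%N (map CodeSeq.code Q) by rewrite -map_comp.
  rewrite sorted_map (eq_sorted (e' := ltn)); last by move=> a b; rewrite /= ltn_add2r.
  rewrite ltn_sorted_uniq_leq map_inj_uniq ?uniqQ /=; last exact: can_inj CodeSeq.codeK.
  rewrite sorted_map; apply: sort_sorted => a b; exact: leq_total.
set K := \sum_(q <- branch s | _) _.
(* The letters kept are those of the vertices on the branch of s alone. *)
have := H L (fun l => (l.1.1.2 != 0%N :> nat) && (l.1.2 == 0%N :> nat)) LP Lsrt.
rewrite /L !big_map.
have idxk v q : (size v <= k)%N -> (idx v q < k.+1)%N.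
  by move=> vk; rewrite /idx; case: ifP => [/branch_size /andP[? ?]|_]; lia.
have lettE q : q \in Q ->
  [/\ (letter q).1.1 = (size q).-1 :> nat, (letter q).1.2 = idx s q :> nat
    & (letter q).2 = idx t q :> nat].
  rewrite memQ => mq; split; rewrite /= inordK ?idxk //.
  by case/orP: mq => /branch_size /andP[? ?]; lia.
pose coef v q : R := if q \in branch v then w (size v - size q) else 0.
have split v : {subset branch v <= Q} ->
    embedding node v = \sum_(q <- Q) coef v q *: x (size q).-1 (node q).
  move=> vQ; rewrite /embedding /coef.
  under [RHS]eq_bigr do rewrite (fun_if (fun c => c *: _)) scale0r.
  rewrite -big_mkcond -[RHS]big_filter; apply: perm_big.
  apply: uniq_perm; rewrite ?branch_uniq ?filter_uniq // => q.
  by rewrite mem_filter; case: (boolP (q \in branch v)) => // /vQ ->.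
have -> : embedding node s - embedding node t =
    \sum_(q <- Q) (coef s q - coef t q) *: x (size q).-1 (node q).
  rewrite !split ?sumrB -?sumrB; last 2 first.
  - by move=> q; rewrite memQ => ->; rewrite orbT.
  - by move=> q; rewrite memQ => ->.
  by apply: eq_bigr => q _; rewrite scalerBl.
have coefE v q : padded_weight (idx v q) = coef v q.
  by rewrite /idx /coef; case: ifP.
have sumE P : \sum_(q <- Q | P q) letter_vector (letter q) (j (CodeSeq.code q + N)%N) =
    \sum_(q <- Q | P q) (coef s q - coef t q) *: x (size q).-1 (node q).
  rewrite [LHS]big_seq_cond [RHS]big_seq_cond; apply: eq_bigr => q /andP[mq _].
  by have [E1 E2 E3] := lettE q mq; rewrite /letter_vector E1 E2 E3 !coefE.
rewrite /= !sumE; apply: le_trans; rewrite le_eqVlt; apply/orP; left; apply/eqP.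
congr (`|_|); rewrite /K -big_filter -[RHS]big_filter.
have keepE : perm_eq [seq q <- branch s | q \notin branch t]
    [seq q <- Q | ((letter q).1.2 != 0%N :> nat) && ((letter q).2 == 0%N :> nat)].
  apply: uniq_perm; rewrite ?filter_uniq ?branch_uniq // => q.
  rewrite !mem_filter; case: (boolP (q \in Q)) => mq; last first.
    by rewrite andbF; move: mq; rewrite memQ negb_or => /andP[/negPf -> _]; rewrite andbF.
  have [_ -> ->] := lettE q mq; rewrite andbT /idx.
  by case: (q \in branch s); case: (q \in branch t).
rewrite (perm_big _ keepE) /= big_seq [RHS]big_seq; apply: eq_bigr => q.
rewrite -(perm_mem keepE) mem_filter /coef => /andP[/negPf -> ->].
by rewrite subr0.
Qed.


End Embedding.

Section DepthK.
Variables (R : realType) (p : R) (X : normedModType R) (x : nat -> nat -> X).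
Variables (w : nat -> R) (C : R).
Hypothesis hp : 1 <= p.
Hypothesis w0 : w 0 = 1.
Hypothesis w_mono : forall i j, (i <= j)%N -> w i <= w j.
Hypothesis w_var : forall n, \sum_(i < n) (w i.+1 - w i) `^ p <= C.
Hypothesis model : generates_lp_asymptotic_model p x.
Hypothesis x0 : weakly_null_array x.

Let w_ge1 i : 1 <= w i. Proof. by rewrite -w0 w_mono. Qed.

Lemma padded_weight_bound k a : (a <= k.+1)%N -> 0 <= padded_weight w a <= w k.
Proof.
case: a => [|a] ak /=; first by rewrite lexx (le_trans _ (w_ge1 k)).
by rewrite w_mono // andbT (le_trans _ (w_ge1 a)).
Qed.

Lemma letter_vector_bound k (l : 'I_k.+1 * 'I_k.+1 * 'I_k.+1) n :
  `|letter_vector x w l n| <= w k.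
Proof.
have [x1 _] := model.
rewrite /letter_vector normrZ x1 mulr1 ler_norml.
have /andP[? ?] := padded_weight_bound (ltnW (ltn_ord l.1.2)).
have /andP[? ?] := padded_weight_bound (ltnW (ltn_ord l.2)).
by apply/andP; split; lra.
Qed.

Lemma letter_vector_weakly_null k (l : 'I_k.+1 * 'I_k.+1 * 'I_k.+1) :
  weakly_null (letter_vector x w l).
Proof.
move=> phi phic; rewrite /letter_vector; set c := _ - _.
rewrite (_ : (fun n => _) = (fun n => c * phi (x l.1.1 n))); last first.
  by apply/funext => n; rewrite linearZ.
rewrite -(mulr0 c); apply: cvgM; first exact: cvg_cst.
exact: x0.
Qed.

(** In the lower bound, the asymptotic model and the suppression of terms each
    cost at most a quarter.  This is harmless, because the left-hand side is at
    least 1 as soon as [s] is not an initial segment of [t]. *)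
Lemma exists_tree_embedding k : exists emb : seq nat -> X,
  (forall s m, (size s < k)%N -> `|emb (rcons s m) - emb s| <= C + 2) /\
  (forall s t, (size s <= k)%N -> (size t <= k)%N ->
    (\sum_(i < size s - size (lcp s t)) w i `^ p) `^ p^-1
      <= `|emb s - emb t| + 2^-1).
Proof.
have wk0 : 0 < w k by exact: lt_le_trans (w_ge1 k).
have w_ge0 i : 0 <= w i by apply: le_trans (w_ge1 i).
have d0 : 0 < 4^-1 :> R by rewrite invr_gt0.
have p0 : 0 < p by exact: lt_le_trans hp.
have [N [kN est]] := asymptotic_model_estimate hp model k wk0 d0.
have [j [jincr keep]] := finite_suppression_unconditional
  (@letter_vector_bound k) (@letter_vector_weakly_null k) k.*2 d0.
have j_ge n : (n <= j n)%N.
  by elim: n => // n IH; apply: leq_ltn_trans IH (jincr _ _ (ltnSn n)).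
(* The shift by N puts every column past N, as the estimate est requires. *)
pose node q := j (CodeSeq.code q + N)%N.
have nodeN q : (N <= node q)%N by apply: leq_trans (j_ge _); rewrite leq_addl.
have node_lt s i l : (i < l < size s)%N -> (node (take i.+1 s) < node (take l.+1 s))%N.
  by move=> il; apply: jincr; rewrite ltn_add2r code_take_lt.
exists (embedding x w node); split=> [s m sk|s t sk tk].
- rewrite embedding_step.
  pose a := edge_coefficient w (size s).
  have := est (size s).+1 a (fun i => node (take i.+1 (rcons s m))).
  have a_ge0 i : 0 <= a i.
    by rewrite /a /edge_coefficient; case: ifP => // _; rewrite subr_ge0 w_mono; lia.
  set S := \sum_(i < _) _ `^ p.
  (* Read from the last row back, the coefficients are w 0, then the
     successive increments of w. *)
  have S1 : 1 <= S <= C + 1.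
    rewrite /S big_ord_recr /= (ger0_norm (a_ge0 _)) {2 4}/a /edge_coefficient ltnn w0 powR1.
    rewrite lerDr sumr_ge0 => [|i _]; last exact: powR_ge0.
    rewrite lerD2r (le_trans _ (w_var (size s))) // le_eqVlt; apply/orP; left.
    rewrite [X in _ == X](reindex_inj rev_ord_inj) /=; apply/eqP.
    apply: eq_bigr => i _; rewrite (ger0_norm (a_ge0 _)) /a /edge_coefficient ltn_ord.
    by congr ((w _ - _) `^ p); have := ltn_ord i; lia.
  have SV : S `^ p^-1 <= S by apply: ler1_powR; [lra|rewrite invf_le1].
  set v := \sum_(i < _) _ => H.
  suff /ler_normlP[] : `| `|v| - S `^ p^-1| <= 4^-1 by lra.
  apply: H => [|i ir|i ir|i l il].
  + by rewrite (leq_trans sk).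
  + rewrite ger0_norm // /a /edge_coefficient; case: ifP => _; last exact: w_mono.
    rewrite lerBlDr (le_trans (w_mono (_ : _ <= k)%N)) ?lerDl //; lia.
  + exact: nodeN.
  + by apply: node_lt; rewrite size_rcons.
- have := embedding_unshared_le N keep sk tk.
  rewrite big_branch.
  set l := size (lcp s t).
  have ls : (l <= size s)%N by apply: size_prefix; exact: prefix_lcpl.
  pose a i := if (i < l)%N then 0 else w (size s - i.+1).
  have := est (size s) a (fun i => node (take i.+1 s)).
  have -> : \sum_(i < size s | take i.+1 s \notin branch t)
      w (size s - size (take i.+1 s)) *: x (size (take i.+1 s)).-1 (node (take i.+1 s))
    = \sum_(i < size s) a i *: x i (node (take i.+1 s)).
    rewrite big_mkcond; apply: eq_bigr => i _; rewrite /a.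
    by rewrite take_branch_lcp // -/l size_takel //; case: ltnP => _; rewrite ?scale0r.
  have -> : \sum_(i < size s) `|a i| `^ p = \sum_(i < size s - l) w i `^ p.
    rewrite -(big_mkord predT (fun i => `|a i| `^ p)).
    rewrite (big_cat_nat (n := l)) //= big_nat big1 ?add0r; last first.
      by move=> i /andP[_ il]; rewrite /a il normr0 powR0 // gt_eqF.
    rewrite -[X in \sum_(X <= _ < _) _]add0n big_addn big_mkord.
    rewrite (reindex_inj rev_ord_inj) /=; apply: eq_bigr => i _.
    rewrite /a ltnNge leq_addl /= ger0_norm //.
    by congr (w _ `^ p); have := ltn_ord i; lia.
  set v := \sum_(i < size s) _; set S := _ `^ p^-1 => H1 H2.
  suff /ler_normlP[] : `| `|v| - S| <= 4^-1 by lra.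
  apply: H1 => [|i ir|i ir|i l' il].
  + exact: leq_trans kN.
  + rewrite /a; case: ifP => _; first by rewrite normr0 ltW.
    by rewrite ger0_norm // w_mono //; lia.
  + exact: nodeN.
  + exact: node_lt.
Qed.

End DepthK.

Lemma embedding_path (R : realType) (X : normedModType R) (emb : seq nat -> X)
    (L : R) (k : nat) (s r : seq nat) :
  (forall s m, (size s < k)%N -> `|emb (rcons s m) - emb s| <= L) ->
  (size (s ++ r) <= k)%N -> `|emb (s ++ r) - emb s| <= L * (size r)%:R.
Proof.
move=> step; elim/last_ind: r => [|r m IH]; first by rewrite cats0 subrr normr0 mulr0.
rewrite -rcons_cat !size_rcons => sk.
apply: le_trans (ler_distD (emb (s ++ r)) _ _) _.
by rewrite -natr1 mulrDr mulr1 addrC lerD ?step // IH // ltnW.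
Qed.

(** * The theorem *)

Theorem theorem4p1 (R : realType) (p : R) (X : completeNormedModType R)
  (hp : 1 <= p)
  (hX : exists x : nat -> nat -> X,
      generates_lp_asymptotic_model p x /\ weakly_null_array x)
  (f : R -> R)
  (f_ge0 : forall t, 0 <= t -> 0 <= f t)
  (f_incr : forall s t, 0 <= s -> s <= t -> f s <= f t)
  (f_int : (\int[lebesgue_measure]_(t in `[1%R, +oo[)
              ((f t / t) `^ p / t)%:E < +oo)%E) :
  exists (F : forall k : nat, tree k -> X) (L c : R),
    [/\ 0 < c,
        forall k, lipschitz_with (fun x y => (tree_dist x y)%:R)
                    (@norm_dist R X) L (F k) &
        forall (k : nat) (t : R), 3 <= t ->
          ((c * f (t / 8))%:E <=
             compression (fun x y => (tree_dist x y)%:R)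
               (@norm_dist R X) (F k) t)%E].
Proof.
have [x [model x0]] := hX.
have [C sumC] := increment_summable hp f_ge0 f_incr f_int.
pose w := weight p f.
have w_var n : \sum_(i < n) (w i.+1 - w i) `^ p <= C.
  apply: le_trans (sumC n.+1).
  rewrite -(big_mkord predT (fun i => (w i.+1 - w i) `^ p)) big_add1 /=.
  rewrite le_eqVlt; apply/orP; left; apply/eqP; apply: eq_bigr => i _.
  by rewrite /w weightS addrAC subrr add0r.
have embk k := cid (exists_tree_embedding hp (weight0 p f)
  (weight_mono p f_ge0) w_var model x0 k).
pose F k (s : tree k) : X := sval (embk k) (val s).
exists F, (C + 2), 32^-1; split; first by rewrite invr_gt0.
- move=> k s t; rewrite /norm_dist /F.
  case: (embk k) => emb [/= step _].
  have /andP[_ sk] := valP s; have /andP[_ tk] := valP t.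
  have /prefixP[r sE] := prefix_lcpl (val s) (val t).
  have /prefixP[q tE] := prefix_lcpr (val s) (val t).
  rewrite /tree_dist; set u := lcp _ _ in sE tE *.
  rewrite sE in sk *; rewrite tE in tk *.
  have -> : (size (u ++ r) - size u + (size (u ++ q) - size u) = size r + size q)%N.
    by rewrite !size_cat; lia.
  apply: le_trans (ler_distD (emb u) _ _) _.
  rewrite [sval s]sE [sval t]tE natrD mulrDr lerD ?(embedding_path step) //.
  by rewrite distrC (embedding_path step).
- move=> k t t3; apply: le_ereal_inf_tmp => _ [[s s'] /= tss' <-].
  rewrite lee_fin /norm_dist /F.
  case: (embk k) => emb [/= _ lower].
  wlog sle : s s' tss' / (size (val s') - size (lcp (val s) (val s'))
       <= size (val s) - size (lcp (val s) (val s')))%N.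
    move=> H; case: (leqP (size (val s') - size (lcp (val s) (val s')))
       (size (val s) - size (lcp (val s) (val s')))) => [|/ltnW] le; first exact: H.
    by rewrite distrC; apply: H; rewrite 1?tree_distC // lcpC.
  have /andP[_ sk] := valP s; have /andP[_ sk'] := valP s'.
  have := lower _ _ sk sk'.
  move: tss' sle; rewrite /tree_dist; set a := (size (val s) - _)%N.
  set b := (_ - _)%N => tab ba.
  have ta : t <= 2 * a%:R.
    by apply: le_trans tab _; rewrite -natrM ler_nat; lia.
  have a1 : (1 < a)%N.
    rewrite ltnNge; apply/negP => a_le1.
    have : a%:R <= 1 :> R by rewrite (ler_nat _ _ 1).
    lra.
  have w1 := weight_sum_ge1 hp f_ge0 (ltnW a1).
  have wf := weight_sum_ge hp f_ge0 f_incr a1.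
  have ff : f (t / 8) <= f (a%:R / 4) by apply: f_incr; lra.
  rewrite -/w in w1 wf *; set Z := _ `^ p^-1 in w1 wf *.
  rewrite mulrC; lra.
Qed.
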